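(* Let $G$ be a finite simple connected non-bipartite graph and let $2\leq x\leq y$ be integers. Then $\gamma_{P,c}(G\times K_{x,y})=\gamma_c(G\times K_2)$.
   Context: Power domination: for $S\subseteq V(X)$, start with $M(S)=N[S]$ and repeatedly add a vertex $w$ whenever some $v\in M(S)$ has $w$ as its unique neighbour outside $M(S)$; $S$ is a connected power dominating set if the final $M(S)$ is $V(X)$ and $\langle S\rangle$ is connected; $\gamma_{P,c}(X)$ is the minimum size of such a set. $\gamma_c(X)$ is the connected domination number (minimum size of a dominating set inducing a connected subgraph). The tensor product $G\times H$ has vertex set $V(G)\times V(H)$, with $(a,b)\sim(x,y)$ iff $ax\in E(G)$ and $by\in E(H)$. $K_{x,y}$ is the complete bipartite graph. *)

(* Defs.v *)
From HB Require Import structures.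
From mathcomp Require Import all_boot.

Set Implicit Arguments.
Unset Strict Implicit.
Unset Printing Implicit Defensive.

Record sgraph := SGraph {
  vertex :> finType;
  edge : rel vertex;
  edge_sym : symmetric edge;
  edge_irr : irreflexive edge
}.

Definition connected_graph (G : sgraph) : bool :=
  (0 < #|G|) && [forall u : G, forall v : G, connect (@edge G) u v].

Definition bipartite (G : sgraph) : Prop :=
  exists A : {set G}, forall u v : G, edge u v -> (u \in A) != (v \in A).

Section Induced.
Variables (G : sgraph) (S : {set G}).

Definition induced_edge : rel {u : G | u \in S} :=
  fun u v => edge (val u) (val v).

Fact induced_sym : symmetric induced_edge.
Proof. by move=> u v; rewrite /induced_edge edge_sym. Qed.

Fact induced_irr : irreflexive induced_edge.
Proof. by move=> u; rewrite /induced_edge edge_irr. Qed.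

Definition induced : sgraph := SGraph induced_sym induced_irr.

End Induced.

Section Tensor.
Variables G H : sgraph.

Definition tensor_edge : rel (G * H) :=
  fun p q => edge p.1 q.1 && edge p.2 q.2.

Fact tensor_sym : symmetric tensor_edge.
Proof. by move=> p q; rewrite /tensor_edge edge_sym (edge_sym p.2). Qed.

Fact tensor_irr : irreflexive tensor_edge.
Proof. by move=> p; rewrite /tensor_edge edge_irr. Qed.

Definition tensor : sgraph := SGraph tensor_sym tensor_irr.

End Tensor.

Section Complete.
Variable n : nat.

Definition complete_edge : rel 'I_n := fun i j => i != j.

Fact complete_sym : symmetric complete_edge.
Proof. by move=> i j; rewrite /complete_edge eq_sym. Qed.

Fact complete_irr : irreflexive complete_edge.
Proof. by move=> i; rewrite /complete_edge eqxx. Qed.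

Definition complete : sgraph := SGraph complete_sym complete_irr.

End Complete.

Section CompleteBipartite.
Variables x y : nat.

Definition complete_bipartite_edge : rel ('I_x + 'I_y) :=
  fun u v => match u, v with
             | inl _, inr _ | inr _, inl _ => true
             | _, _ => false
             end.

Fact complete_bipartite_sym : symmetric complete_bipartite_edge.
Proof. by case=> i [j|j]. Qed.

Fact complete_bipartite_irr : irreflexive complete_bipartite_edge.
Proof. by case. Qed.

Definition complete_bipartite : sgraph :=
  SGraph complete_bipartite_sym complete_bipartite_irr.

End CompleteBipartite.

Section Domination.
Variable G : sgraph.
Implicit Types S M : {set G}.

Definition closed_nbhd S : {set G} :=
  [set w | (w \in S) || [exists v in S, edge v w]].

Definition dominating S : bool := closed_nbhd S == [set: G].

(* One propagation step: M' is M with one vertex w added, where w is the      *)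
(* unique neighbour outside M of some v in M.                                 *)
Definition propagates : rel {set G} :=
  fun M M' => [exists v in M, exists w,
    ([set u | edge v u] :\: M == [set w]) && (M' == w |: M)].

(* The set left when no step applies does not depend on the order of the      *)
(* steps, so it is the whole vertex set iff some sequence of steps reaches it. *)
Definition power_dominating S : bool :=
  connect propagates (closed_nbhd S) [set: G].

Definition connected_dominating S : bool :=
  dominating S && connected_graph (induced S).

Definition connected_power_dominating S : bool :=
  power_dominating S && connected_graph (induced S).

(* Least cardinality of a set satisfying P, provided the whole vertex set     *)
(* satisfies P; both properties used below hold of the whole vertex set as    *)
(* soon as G is connected.                                                    *)
Definition min_size (P : pred {set G}) : nat :=
  #|[arg min_(S < [set: G] | P S) #|S|]|.

End Domination.

Definition gamma_c (G : sgraph) : nat := min_size (@connected_dominating G).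

Definition gamma_Pc (G : sgraph) : nat :=
  min_size (@connected_power_dominating G).

(* Main.v *)
Require Import Defs.
From HB Require Import structures.
From mathcomp Require Import all_boot.

(**
The vertices (g, i), for i in one side of K_{x,y}, are twins, and each side has
at least two elements. If a whole twin class lies outside M, no vertex can force
a single one of its members, so a power dominating set of G x K_{x,y} already
dominates a member of every class; collapsing each side of K_{x,y} to a point
therefore gives a connected dominating set of G x K_2. Conversely, G x K_2 has
no universal vertex, so a connected dominating set of it is totally dominating;
its lift along an inclusion of K_2 into K_{x,y} then dominates all twins.
Both minima are attained because G x K_2 is connected for G non-bipartite.
*)

Set Implicit Arguments.
Unset Strict Implicit.
Unset Printing Implicit Defensive.

(** * Homomorphisms, connectivity and attained minima *)

Lemma connect_hom (T U : finType) (e : rel T) (e' : rel U) (h : T -> U) u v :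
    {homo h : a b / e a b >-> e' a b} ->
  connect e u v -> connect e' (h u) (h v).
Proof.
move=> hom_h /connectP[p ep ->]; apply/connectP; exists (map h p).
  exact: (homo_path (e := e)).
by rewrite last_map.
Qed.

Lemma connected_graphP (G : sgraph) :
  reflect ((exists u : G, true) /\ forall u v : G, connect (@edge G) u v)
          (connected_graph G).
Proof.
apply: (iffP andP) => [[/card_gt0P[u _] /forallP cG]|[[u _] cG]].
  by split=> [|v w]; [exists u | apply/(forallP (cG v))].
split; first by apply/card_gt0P; exists u.
by apply/forallP => v; apply/forallP.
Qed.

Lemma connected_graph_surj_hom (G H : sgraph) (h : G -> H) :
    {homo h : u v / edge u v >-> edge u v} -> (forall w, exists u, h u = w) ->
  connected_graph G -> connected_graph H.
Proof.
move=> hom_h surj_h /connected_graphP[[u _] cG]; apply/connected_graphP.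
split=> [|w1 w2]; first by exists (h u).
have [v1 <-] := surj_h w1; have [v2 <-] := surj_h w2.
exact: connect_hom (cG v1 v2).
Qed.

Lemma connected_induced_setT (G : sgraph) :
  connected_graph G -> connected_graph (induced [set: G]).
Proof.
apply: (@connected_graph_surj_hom G (induced [set: G])
          (fun u => Sub u (in_setT u))) => // w.
by exists (val w); apply: val_inj.
Qed.

Lemma connected_induced_imset (G H : sgraph) (h : G -> H) (S : {set G}) :
    {homo h : u v / edge u v >-> edge u v} ->
  connected_graph (induced S) -> connected_graph (induced (h @: S)).
Proof.
move=> hom_h; apply: (@connected_graph_surj_hom (induced S) (induced (h @: S))
  (fun u => Sub (h (val u)) (imset_f h (valP u)))).
  by move=> u v; apply: hom_h.
case=> w Sw; have /imsetP[u Su def_w] := Sw.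
by exists (Sub u Su); apply: val_inj; rewrite /= def_w.
Qed.

(** As soon as one set satisfies [P], a minimiser exists, so the choice inside [arg min_] succeeds
    and its default [[set: G]] is never returned. *)
Lemma min_sizeP (G : sgraph) (P : pred {set G}) (S0 : {set G}) : P S0 ->
  exists2 S, P S /\ #|S| = min_size P & forall S', P S' -> #|S| <= #|S'|.
Proof.
move=> PS0; have [S PS minS] := arg_minnP (fun S : {set G} => #|S|) PS0.
exists S => //; split=> //; rewrite /min_size /arg_min /extremum.
case: pickP => [S' /andP[PS' /forallP minS']|/(_ S)].
  by apply/eqP; rewrite eqn_leq minS //= (implyP (minS' S)).
by rewrite /= PS; case: forallP => // [[]] S'; apply/implyP/minS.
Qed.

(** * Domination, twins and total domination *)

Lemma dominatingP (G : sgraph) (S : {set G}) :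
  reflect (forall w, w \in S \/ exists2 v, v \in S & edge v w) (dominating S).
Proof.
apply: (iffP eqP) => [domS w|domS].
  have: w \in closed_nbhd S by rewrite domS.
  by rewrite inE => /orP[|/exists_inP]; [left | right].
apply/setP=> w; rewrite !inE; apply/orP.
by have [|/exists_inP] := domS w; [left | right].
Qed.

Lemma dominating_power (G : sgraph) (S : {set G}) :
  dominating S -> power_dominating S.
Proof. by move=> /eqP domS; rewrite /power_dominating domS. Qed.

(** A vertex [v] sees both twins or neither, so while both lie outside [M] neither can be its only
    neighbour there. *)
Lemma propagates_twin_free (G : sgraph) (u1 u2 : G) (M M' : {set G}) :
    u1 != u2 -> (forall v : G, edge v u1 = edge v u2) -> propagates M M' ->
  (u1 \notin M) && (u2 \notin M) -> (u1 \notin M') && (u2 \notin M').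
Proof.
move=> neq_u twin_u /exists_inP[v _ /existsP[w /andP[/eqP vw /eqP->]]].
case/andP=> Mu1 Mu2.
have eq_w : (u1 == w) = (u2 == w).
  by move/setP: vw => vw; have := vw u1; rewrite !inE Mu1 twin_u => <-;
     have := vw u2; rewrite !inE Mu2 => <-.
have neq_w : u2 != w by apply: contraNneq neq_u => u2w; rewrite u2w eq_w u2w.
by rewrite !inE eq_w (negPf neq_w) (negPf Mu1).
Qed.

(** By contraposition: twins both missed by the closed neighbourhood stay outside after every step,
    so [[set: G]] is never reached. *)
Lemma power_dominating_twin (G : sgraph) (S : {set G}) (u1 u2 : G) :
    u1 != u2 -> (forall v : G, edge v u1 = edge v u2) -> power_dominating S ->
  (u1 \in closed_nbhd S) || (u2 \in closed_nbhd S).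
Proof.
move=> neq_u twin_u /connectP[p]; rewrite -[_ || _]negbK negb_or.
elim: p (closed_nbhd S) => [|M' p IHp] M /=.
  by move=> _ <-; rewrite !inE.
case/andP=> prop_M /IHp{}IHp /IHp; apply: contra.
exact: propagates_twin_free prop_M.
Qed.

Lemma connected_dominating_total (G : sgraph) (S : {set G}) :
    (forall w : G, exists2 z, z != w & ~~ edge w z) ->
    connected_dominating S ->
  forall w, exists2 v, v \in S & edge v w.
Proof.
move=> no_univ /andP[/dominatingP domS /connected_graphP[_ cS]] w.
have [Sw|//] := domS w; have [z neq_zw not_wz] := no_univ w.
(* The vertex [z] is not dominated by [w], so [S] contains something other than [w]. *)
have [s Ss neq_sw]: exists2 s, s \in S & s != w.
  have [Sz|[v Sv vz]] := domS z; first by exists z.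
  by exists v => //; apply: contraNneq not_wz => <-.
(* The path inside [S] from [w] to [s] is nonempty, and its first step is a neighbour of [w] in
   [S]. *)
have /connectP[[|t p] /=] := cS (Sub w Sw) (Sub s Ss).
  by move=> _ [eq_sw]; rewrite eq_sw eqxx in neq_sw.
by case/andP=> wt _ _; exists (val t); [apply: valP | rewrite edge_sym].
Qed.

(** * Connectivity of the bipartite double cover *)

Section DoubleCover.

Variable G : sgraph.
Local Notation G2 := (tensor G (complete 2)).
Local Notation flip := (@rev_ord 2).
Local Notation conn := (connect (@edge G2)).

Lemma edge_double_cover (u v : G) (i j : 'I_2) :
  @edge G2 (u, i) (v, j) = edge u v && (j == flip i).
Proof.
by congr (_ && _); case: i j => [[|[|i]] ?] [[|[|j]] ?].
Qed.

Lemma flip_neq (i : 'I_2) : flip i != i.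
Proof. by case: i => [[|[|i]] ?]. Qed.

Lemma I2_cases (i j : 'I_2) : i = j \/ i = flip j.
Proof.
case: i j => [[|[|i]] ?] [[|[|j]] ?] //; (try by left; apply: val_inj);
  by right; apply: val_inj.
Qed.

Lemma double_cover_no_universal (w : G2) : exists2 z, z != w & ~~ edge w z.
Proof.
case: w => u i; exists (u, flip i); last by rewrite edge_double_cover edge_irr.
by rewrite xpair_eqE (negPf (flip_neq i)) andbF.
Qed.

Lemma double_cover_connect_sym : connect_sym (@edge G2).
Proof. by apply: sym_connect_sym; apply: edge_sym. Qed.

Lemma connect_flip u v (i j : 'I_2) :
  conn (u, i) (v, j) -> conn (u, flip i) (v, flip j).
Proof.
apply: (connect_hom (h := fun p : G2 => (p.1, flip p.2) : G2)).
move=> [a k] [b l].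
rewrite (edge_double_cover a b k l) (edge_double_cover a b (flip k) (flip l)).
by rewrite (inj_eq rev_ord_inj).
Qed.

(** The final index depends on the parity of the length of the lifted path, hence the
    existential. *)
Lemma connect_double_cover_lift u v (i : 'I_2) :
  connect (@edge G) u v -> exists j, conn (u, i) (v, j).
Proof.
move=> /connectP[p]; elim: p u i => [|a p IHp] u i /=.
  by move=> _ ->; exists i.
case/andP=> ua ep def_v; have [j aj] := IHp a (flip i) ep def_v.
exists j; apply: connect_trans aj; apply: connect1.
by rewrite edge_double_cover ua eqxx.
Qed.

Lemma connected_double_cover :
  connected_graph G -> ~ bipartite G -> connected_graph G2.
Proof.
move=> /connected_graphP[[u _] cG] nbipG.
(* If the two vertices above [u] are joined, a lifted path that ends at the wrong index is corrected
   by flipping it. *)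
have [conn_u|nconn_u] := boolP (conn (u, ord0) (u, flip ord0)).
  have conn_all p : conn (u, ord0) p.
    case: p => v i; have [j uv] := connect_double_cover_lift ord0 (cG u v).
    have [->//|->] := I2_cases i j.
    exact: connect_trans conn_u (connect_flip uv).
  apply/connected_graphP; split=> [|p q]; first by exists (u, ord0).
  by apply: connect_trans (conn_all q); rewrite double_cover_connect_sym.
(* The component of (u, 0) meets each fibre exactly once, hence 2-colours G. *)
case: nbipG; exists [set v | conn (u, ord0) (v, ord0)] => v w vw.
(* Flipping a path to [(a, i)] and joining it to one to [(a, flip i)] would connect the two vertices
   above [u]. *)
have once a i : conn (u, ord0) (a, i) -> ~~ conn (u, ord0) (a, flip i).
  move=> ai; apply: contra nconn_u => aFi; apply: connect_trans aFi _.
  by rewrite double_cover_connect_sym connect_flip.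
have mem a i : conn (u, ord0) (a, flip i) = ~~ conn (u, ord0) (a, i).
  apply/idP/idP => [/once|]; first by rewrite rev_ordK.
  have [j aj] := connect_double_cover_lift ord0 (cG u a).
  by have [<-|<-] := I2_cases j i; rewrite ?aj // (_ : flip i = j).
have ->: (w \in [set v | conn (u, ord0) (v, ord0)]) = conn (u, ord0) (w, ord0).
  by rewrite inE.
rewrite inE -[conn _ (w, _)]negbK -mem.
suff ->: conn (u, ord0) (w, flip ord0) = conn (u, ord0) (v, ord0).
  by case: (conn _ _).
apply/esym/(same_connect_r double_cover_connect_sym)/connect1.
by rewrite edge_double_cover vw eqxx.
Qed.

End DoubleCover.

(** * Passing between the two tensor products *)

Section Collapse.

Variables (G : sgraph) (m n : nat).
Local Notation G2 := (tensor G (complete 2)).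
Local Notation GK := (tensor G (complete_bipartite m.+2 n.+2)).

Definition side (b : complete_bipartite m.+2 n.+2) : 'I_2 :=
  if b is inl _ then ord0 else ord_max.

Definition vertex_of_side (i : 'I_2) : complete_bipartite m.+2 n.+2 :=
  if i == ord0 then inl ord0 else inr ord0.

Definition collapse (p : GK) : G2 := (p.1, side p.2).

Definition lift_double_cover (p : G2) : GK := (p.1, vertex_of_side p.2).

(** The equality makes vertices with the same image twins, and it lets adjacency be pulled back
    along [collapse] as well as pushed forward. *)
Lemma edge_collapse (p q : GK) : edge (collapse p) (collapse q) = edge p q.
Proof. by case: p q => [u [i|i]] [v [j|j]]. Qed.

Lemma lift_double_coverK : cancel lift_double_cover collapse.
Proof.
by case=> u i; congr (_, _); apply: val_inj; case: i => [[|[|i]] ?].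
Qed.

Lemma collapse_power_dominating (T : {set GK}) :
  power_dominating T -> dominating (collapse @: T).
Proof.
move=> pdT; apply/dominatingP => w.
suff [q qw]: exists2 q, collapse q = w & q \in closed_nbhd T.
  rewrite inE => /orP[Tq|/exists_inP[v Tv vq]].
    by left; rewrite -qw imset_f.
  by right; exists (collapse v); rewrite ?imset_f // -qw edge_collapse.
(* Each side has at least two vertices, so every fibre of [collapse] contains a pair of twins. *)
have [q1 [q2 [neq_q q1w q2w]]]:
    exists q1 q2, [/\ q1 != q2, collapse q1 = w & collapse q2 = w].
  case: w => u i; have [->|->] := I2_cases i ord0.
    by exists (u, inl ord0), (u, inl ord_max); rewrite xpair_eqE eqxx.
  exists (u, inr ord0), (u, inr ord_max); rewrite xpair_eqE eqxx.
  by split=> //; congr (_, _); apply: val_inj.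
have [|q1T|q2T] := orP (power_dominating_twin neq_q _ pdT).
- by move=> v; rewrite -!edge_collapse q1w q2w.
- by exists q1.
- by exists q2.
Qed.

Lemma collapse_connected_power_dominating (T : {set GK}) :
  connected_power_dominating T -> connected_dominating (collapse @: T).
Proof.
case/andP=> /collapse_power_dominating domT cT; rewrite /connected_dominating.
rewrite domT; apply: connected_induced_imset cT => p q.
by rewrite edge_collapse.
Qed.

Lemma lift_connected_dominating (S : {set G2}) :
  connected_dominating S -> connected_power_dominating (lift_double_cover @: S).
Proof.
move=> cdS; have totS := connected_dominating_total
  (@double_cover_no_universal G) cdS.
case/andP: cdS => _ cS; apply/andP; split.
  (* The lift holds one vertex per fibre at most, so [collapse w] lying in [S] does not put [w] in
     the lift; a neighbour in [S] does dominate [w]. *)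
  apply/dominating_power/dominatingP => w; right.
  have [v Sv vw] := totS (collapse w); exists (lift_double_cover v).
    exact: imset_f.
  by rewrite -edge_collapse lift_double_coverK.
apply: connected_induced_imset cS => p q.
by rewrite -[edge (lift_double_cover p) _]edge_collapse !lift_double_coverK.
Qed.

End Collapse.

Theorem theorem13 (G : sgraph) (x y : nat)
  (connG : connected_graph G) (nbipG : ~ bipartite G)
  (x_ge2 : 2 <= x) (x_le_y : x <= y) :
  gamma_Pc (tensor G (complete_bipartite x y)) = gamma_c (tensor G (complete 2)).
Proof.
have y_ge2 := leq_trans x_ge2 x_le_y.
rewrite /gamma_Pc /gamma_c.
case: x y x_ge2 y_ge2 {x_le_y} => [|[|m]] [|[|n]] // _ _.
have cdT: connected_dominating [set: tensor G (complete 2)].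
  rewrite /connected_dominating connected_induced_setT; last first.
    exact: connected_double_cover.
  by rewrite andbT; apply/dominatingP => w; left; rewrite inE.
have [S [cdS <-] minS] := min_sizeP cdT.
have cpdS := lift_connected_dominating m n cdS.
have [T [cpdT <-] minT] := min_sizeP cpdS.
(* Minimal sets are carried both ways by [lift_double_cover] and [collapse], and images never
   grow. *)
apply/eqP; rewrite eqn_leq; apply/andP; split.
  exact: leq_trans (minT _ cpdS) (leq_imset_card _ _).
apply: leq_trans (leq_imset_card (@collapse G m n) T).
exact/minS/collapse_connected_power_dominating.
Qed.
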